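(* There are universal constants $c>0$ and $n_0$ such that for any integers $k\ge3$, $s\le k\wedge n$, $n\ge n_0$ and for any $\varepsilon\in[0,1]$, we have $$\inf_{\bar{\boldsymbol\theta}_n}R_{\mathrm{TV}}^{\mathrm{HC}}(n,\varepsilon,\Delta_s^{k-1},\bar{\boldsymbol\theta}_n)\ge c\{(s/n)^{1/2}+\varepsilon\},$$ $$\inf_{\bar{\boldsymbol\theta}_n}R_{\mathrm{H}}^{\mathrm{HC}}(n,\varepsilon,\Delta_s^{k-1},\bar{\boldsymbol\theta}_n)\ge c\{(s/n)^{1/2}+\varepsilon^{1/2}\},$$ $$\inf_{\bar{\boldsymbol\theta}_n}R_{\mathbb L^2}^{\mathrm{HC}}(n,\varepsilon,\Delta_s^{k-1},\bar{\boldsymbol\theta}_n)\ge c\{(1/n)^{1/2}+\varepsilon\},$$ where $\inf_{\bar{\boldsymbol\theta}_n}$ stands for the infimum over all measurable functions $\bar{\boldsymbol\theta}_n$ from $(\Delta^{k-1})^n$ to $\Delta^{k-1}$.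
   Context: Here $k\wedge n=\min(k,n)$. The probability simplex is $\Delta^{k-1}=\{\boldsymbol v\in\mathbb R_+^k: v_1+\dots+v_k=1\}$, and $\Delta_s^{k-1}$ is the set of all $\boldsymbol v\in\Delta^{k-1}$ having at most $s$ non-zero entries. Distances on $\Delta^{k-1}$: $d_{\mathrm{TV}}(\boldsymbol\theta,\boldsymbol\theta')=\frac12\sum_{j=1}^k|\theta_j-\theta'_j|$; $d_{\mathrm H}(\boldsymbol\theta,\boldsymbol\theta')=\big(\sum_{j=1}^k(\sqrt{\theta_j}-\sqrt{\theta'_j})^2\big)^{1/2}$; $d_{\mathbb L^2}(\boldsymbol\theta,\boldsymbol\theta')=\big(\sum_{j=1}^k(\theta_j-\theta'_j)^2\big)^{1/2}$. Huber's contamination (HC): for $\boldsymbol\theta^*\in\Delta^{k-1}$, $\mathcal M_n^{\mathrm{HC}}(\varepsilon,\boldsymbol\theta^* )$ is the set of all joint distributions $\boldsymbol P_n$ of $(\boldsymbol X_1,\dots,\boldsymbol X_n)$ such that $\boldsymbol X_1,\dots,\boldsymbol X_n$ are i.i.d. with distribution $(1-\varepsilon)\boldsymbol P+\varepsilon\boldsymbol Q$, where $\boldsymbol P$ (the reference distribution) is any probability distribution on $\Delta^{k-1}$ with mean $\boldsymbol\theta^*$ and $\boldsymbol Q$ is any probability distribution on $\Delta^{k-1}$. Worst-case risk: for an estimator $\hat{\boldsymbol\theta}_n$ (a measurable function of $\boldsymbol X_1,\dots,\boldsymbol X_n$), a set $\Theta\subset\Delta^{k-1}$ and $\square\in\{\mathrm{TV},\mathrm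 H,\mathbb L^2\}$, $$R_\square^{\mathrm{HC}}(n,\varepsilon,\Theta,\hat{\boldsymbol\theta}_n)=\sup_{\boldsymbol\theta^*\in\Theta}\ \sup_{\boldsymbol P_n\in\mathcal M_n^{\mathrm{HC}}(\varepsilon,\boldsymbol\theta^* )}\mathbf E_{\boldsymbol P_n}[d_\square(\hat{\boldsymbol\theta}_n,\boldsymbol\theta^* )].$$
   Formalization: The formal theorem assumes s ≥ 2: for s = 1 the claim is false (at ε = 0 every observation equals the vertex θ*, so the estimator X_1 has zero risk), and for s = 0 the class Δ_s^{k-1} is empty. *)

(* Defs.v *)
From HB Require Import structures.
From mathcomp Require Import all_boot all_order all_algebra.
From mathcomp Require Import all_classical all_reals all_analysis.

Set Implicit Arguments.
Unset Printing Implicit Defensive.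

Import Order.TTheory GRing.Theory Num.Theory.
Import numFieldNormedType.Exports.

Local Open Scope classical_set_scope.
Local Open Scope ring_scope.

(* R^k is [k.-tuple R] and (R^k)^n is [n.-tuple (k.-tuple R)], both with the
   library's product sigma-algebra.  The simplex is kept as a subset of R^k:
   a distribution on it is a probability measure on R^k giving it mass 1, and
   a function on it is a function on R^k considered only on that subset. *)

Section simplex.
Context {R : realType} {k : nat}.
Implicit Types v t u : k.-tuple R.

Definition simplex : set (k.-tuple R) :=
  [set v | (forall j, 0 <= tnth v j) /\ \sum_(j < k) tnth v j = 1].

Definition sparse_simplex (s : nat) : set (k.-tuple R) :=
  [set v | simplex v /\ (#|[set j : 'I_k | tnth v j != 0%R]%SET| <= s)%N].

Definition dTV t u : R := 2^-1 * \sum_(j < k) `|tnth t j - tnth u j|.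

Definition dH t u : R :=
  Num.sqrt (\sum_(j < k) (Num.sqrt (tnth t j) - Num.sqrt (tnth u j)) ^+ 2).

Definition dL2 t u : R := Num.sqrt (\sum_(j < k) (tnth t j - tnth u j) ^+ 2).

End simplex.

Section iid.
Context {d : measure_display} {T : measurableType d} {R : realType}.

(* [Pn] is the joint law of (X_1, ..., X_n), the X_i being the coordinates:
   each X_i has law [mu] (a set function), and they are mutually independent.
   Independence over subfamilies is included by taking [A i = setT]. *)
Definition iid_with_law (n : nat) (mu : set T -> \bar R)
    (Pn : probability (n.-tuple T) R) : Prop :=
  (forall (i : 'I_n) (A : set T), measurable A ->
     Pn [set x | A (tnth x i)] = mu A) /\
  (forall A : 'I_n -> set T, (forall i, measurable (A i)) ->
     Pn [set x | forall i, A i (tnth x i)] =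
     (\prod_(i < n) Pn [set x | A i (tnth x i)])%E).

End iid.

Section huber.
Context {R : realType} {k : nat}.

Definition HC_mixture (eps : R) (P Q : probability (k.-tuple R) R) :
    set (k.-tuple R) -> \bar R :=
  fun A => ((1 - eps)%:E * P A + eps%:E * Q A)%E.

Definition HC_model (n : nat) (eps : R) (theta : k.-tuple R) :
    set (probability (n.-tuple (k.-tuple R)) R) :=
  [set Pn | exists P Q : probability (k.-tuple R) R,
    [/\ P simplex = 1%E,
        Q simplex = 1%E,
        forall j, ('E_P[fun x => tnth x j])%E = (tnth theta j)%:E &
        iid_with_law (HC_mixture eps P Q) Pn]].

Definition samples (n : nat) : set (n.-tuple (k.-tuple R)) :=
  [set x | forall i, simplex (tnth x i)].

Definition estimators (n : nat) : set (n.-tuple (k.-tuple R) -> k.-tuple R) :=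
  [set est | measurable_fun (@samples n) est /\
             (forall x, samples x -> simplex (est x))].

(* The integral is restricted to [samples n], a set of full measure under every
   law of the model, as [est] is unconstrained outside of it. *)
Definition HC_risk (dist : k.-tuple R -> k.-tuple R -> R) (n : nat) (eps : R)
    (Theta : set (k.-tuple R)) (est : n.-tuple (k.-tuple R) -> k.-tuple R) :
    \bar R :=
  ereal_sup [set ereal_sup
    [set (\int[Pn]_(x in @samples n) (dist (est x) theta)%:E)%E
      | Pn in HC_model eps theta] | theta in Theta].

Definition HC_minimax (dist : k.-tuple R -> k.-tuple R -> R) (n : nat) (eps : R)
    (Theta : set (k.-tuple R)) : \bar R :=
  ereal_inf [set HC_risk dist eps Theta est | est in @estimators n].

End huber.

(* Main.v *)
Require Import Defs.
From HB Require Import structures.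
From mathcomp Require Import all_boot all_order all_algebra.
From mathcomp Require Import all_classical all_reals all_analysis.
From mathcomp Require Import measurable_realfun zify ring lra.

Import Order.TTheory GRing.Theory Num.Theory.
Import numFieldNormedType.Exports.

Local Open Scope classical_set_scope.
Local Open Scope ring_scope.

(** Each lower bound has a contamination part, in [eps], and a sampling part, in
    [1 / n].  They are proved separately and averaged, since the risk is at
    least the larger of the two.

    Contamination part ([contamination_lower_bound]).  Let
    [M = (1 - eps) d_e0 + eps d_e1] be the mixture of the point masses at two
    vertices [e0], [e1] of the simplex.  It arises in two ways: with reference law
    [d_e0] and contamination [d_e1], or with reference law and contamination
    both equal to [M].  The sample has the same law in both cases, while the
    reference means [e0] and [(1 - eps) e0 + eps e1] are at distance of order
    [eps] (total variation, L2) or [sqrt eps] (Hellinger), so that no estimator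
    can be strictly within half of this distance of both.  The construction covers all
    [eps] in [0, 1].

    Sampling part ([sampling_lower_bound]).  Taking the contamination equal to
    the reference law shows that every uncontaminated i.i.d. law belongs to the
    model.  With [m] disjoint pairs of vertices, perturb the uniform weights
    [1 / (2m)] on the two points of each pair to [(1 + a) / (2m)] and
    [(1 - a) / (2m)], a sign deciding which point gets more.  For
    [a = sqrt (m / n) / 2] changing one sign is not detectable from [n]
    observations: the Hellinger affinity of the two samples is at least
    [(1 - a^2 / m)^n >= 3/4] ([prod_affinity]).  Averaging over all signs
    ([assouad]) gives a total error of order [a] over the [m] coordinates.
    The choice [m = s / 2] gives the rate [sqrt (s / n)] for total variation,
    and for Hellinger because [dTV <= dH] on the simplex; [m = 1] gives the rate
    [sqrt (1 / n)] for the L2 distance.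

    All laws involved are supported on vertices, hence are finite combinations
    of Dirac masses, and every expectation is a finite sum
    ([HC_model_discrete]). *)

(** * Discrete laws in the contamination model *)

Lemma exists_discrete_law {d : measure_display} {T : measurableType d}
    {R : realType} {I : finType} (w : I -> R) (x : I -> T) :
  (forall i, 0 <= w i) -> \sum_i w i = 1 ->
  exists P : probability T R,
    (forall A, P A = (\sum_i w i * (x i \in A)%:R)%:E) /\
    (forall (D : set T) (f : T -> R), measurable D -> measurable_fun D f ->
       (forall i, D (x i)) ->
       (\int[P]_(y in D) (f y)%:E)%E = (\sum_i w i * f (x i))%:E).
Proof.
move=> w0 w1.
have [i0 _|I0] := pickP (fun _ : I => true); last first.
  by have := w1; rewrite big_pred0 // => /eqP; rewrite eq_sym oner_eq0.
pose idx (j : nat) : I := nth i0 (enum I) j.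
pose mu_ (j : nat) : {measure set T -> \bar R} :=
  mscale (NngNum (w0 (idx j))) \d_(x (idx j)).
pose mu : {measure set T -> \bar R} := msum mu_ #|I|.
have sumI (V : nmodType) (g : I -> V) : \sum_(j < #|I|) g (idx j) = \sum_i g i.
  by rewrite -(big_enum _ _ I) (big_nth i0) big_mkord -cardE.
have muE A : mu A = (\sum_i w i * (x i \in A)%:R)%:E.
  rewrite /mu /= /msum (sumI _ (fun i => (mscale (NngNum (w0 i)) \d_(x i)) A)).
  by rewrite -sumEFin; apply: eq_bigr => i _; rewrite /mscale /= diracE EFinM.
have mu1 : mu setT = 1%E.
  rewrite muE -[X in _ = X%:E]w1; congr EFin.
  by apply: eq_bigr => i _; rewrite in_setT mulr1.
pose P : probability T R := HB.pack (Measure.sort mu) (Measure.class mu)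
  (Measure_isProbability.Build _ _ _ mu mu1).
exists P; split=> [A|D f mD mf Dx]; first exact: muE.
have ge0P (g : T -> \bar R) : measurable_fun D g ->
    (forall y, D y -> (0 <= g y)%E) ->
    (\int[P]_(y in D) g y)%E = (\sum_i (w i)%:E * g (x i))%E.
  move=> mg g0; transitivity (\int[mu]_(y in D) g y)%E; first by [].
  rewrite ge0_integral_measure_sum //.
  rewrite (sumI _ (fun i => \int[mscale (NngNum (w0 i)) \d_(x i)]_(y in D) g y)%E).
  apply: eq_bigr => i _.
  rewrite ge0_integral_mscale // integral_dirac //= diracE mem_set //.
  by rewrite mul1e.
have /measurable_EFinP mf' := mf.
rewrite integralE !ge0P //; first last.
- exact: measurable_funepos.
- exact: measurable_funeneg.
under eq_bigr do rewrite funeposE /= -EFin_max -EFinM.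
under [X in (_ - X)%E]eq_bigr do rewrite funenegE /= -EFin_max -EFinM.
rewrite !sumEFin -EFinB -sumrB; congr EFin; apply: eq_bigr => i _.
by rewrite -mulrBr /Num.max; do 2 case: ifP => ?; congr (_ * _); lra.
Qed.

(** Expanding the product of sums over functions [f]: for probability weights
    [w] this is the independence of the coordinates of a sample drawn with
    product weights. *)
Lemma sum_prod_ffunM {R : comRingType} {I : finType} {n : nat}
    (w : I -> R) (g : 'I_n -> I -> R) :
  \sum_(f : {ffun 'I_n -> I}) (\prod_i w (f i)) * (\prod_i g i (f i)) =
  \prod_(i < n) \sum_j w j * g i j.
Proof.
rewrite bigA_distr_bigA /=; apply: eq_bigr => f _.
by rewrite -big_split.
Qed.

Lemma sum_prod_ffun {R : comRingType} {I : finType} (n : nat) (w : I -> R) :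
  \sum_(f : {ffun 'I_n -> I}) \prod_i w (f i) = (\sum_j w j) ^+ n.
Proof.
rewrite -(bigA_distr_bigA (fun (_ : 'I_n) j => w j)) /=.
by rewrite prodr_const card_ord.
Qed.

Section discrete_model.
Context {R : realType} {k : nat}.

Lemma measurable_simplex : measurable (@simplex R k).
Proof.
have -> : @simplex R k =
    (\bigcap_(j in [set: 'I_k]) ((fun v : k.-tuple R => tnth v j) @^-1` `[0, +oo[)) `&`
    ((fun v : k.-tuple R => \sum_(j < k) tnth v j) @^-1` [set 1]).
  apply/seteqP; split=> [v [v0 v1]|v [v0 v1]]; split=> //.
    by move=> j _ /=; rewrite in_itv /= v0.
  by move=> j; have := v0 j I; rewrite /= in_itv /= andbT.
apply: measurableI.
  apply: fin_bigcap_measurable => // j _.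
  by rewrite -[X in measurable X]setTI; apply: measurable_tnth.
rewrite -[X in measurable X]setTI.
have mS : measurable_fun setT (fun v : k.-tuple R => \sum_(j < k) tnth v j).
  by apply: measurable_sum => j; exact: measurable_tnth.
exact: mS.
Qed.

Lemma measurable_samples n : measurable (@samples R k n).
Proof.
have -> : @samples R k n = \bigcap_(i in [set: 'I_n])
    ((fun x : n.-tuple (k.-tuple R) => tnth x i) @^-1` (@simplex R k)).
  by apply/seteqP; split=> [x xs i _|x xs i]; [exact: xs|exact: (xs i I)].
apply: fin_bigcap_measurable => // i _.
by rewrite -[X in measurable X]setTI; apply: measurable_tnth => //;
  exact: measurable_simplex.
Qed.

Definition sample_of {I : finType} {n} (x : I -> k.-tuple R) (f : {ffun 'I_n -> I}) :
    n.-tuple (k.-tuple R) := [tuple x (f i) | i < n].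

(** If the probability weights [m = (1 - eps) p + eps q] on a finite family of
    points of the simplex are used for [n] independent draws, the law of the
    sample is in the model at the mean of [p].  The lemma also evaluates
    integrals against this law, so that measure theory can be left behind.
    Only [m] enters the integral: different splittings [(p, q)] of the same [m]
    cannot be told apart. *)
Lemma HC_model_discrete {I : finType} (n : nat) (eps : R) (x : I -> k.-tuple R)
    (p q m : I -> R) (theta : k.-tuple R) :
  (forall i, 0 <= p i) -> \sum_i p i = 1 ->
  (forall i, 0 <= q i) -> \sum_i q i = 1 ->
  (forall i, 0 <= m i) ->
  (forall i, m i = (1 - eps) * p i + eps * q i) ->
  (forall i, simplex (x i)) ->
  (forall j, tnth theta j = \sum_i p i * tnth (x i) j) ->
  exists2 Pn, HC_model (n := n) eps theta Pn &
    forall g : n.-tuple (k.-tuple R) -> R,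
      measurable_fun (@samples R k n) g ->
      (\int[Pn]_(y in @samples R k n) (g y)%:E)%E =
      (\sum_(f : {ffun 'I_n -> I}) (\prod_i m (f i)) * g (sample_of x f))%:E.
Proof.
move=> p0 p1 q0 q1 m0 mE xS thetaE.
have m1 : \sum_i m i = 1.
  transitivity (\sum_i ((1 - eps) * p i + eps * q i)).
    by apply: eq_bigr => i _; rewrite mE.
  by rewrite big_split /= -!mulr_sumr p1 q1 !mulr1 subrK.
have [P [PE Pint]] := exists_discrete_law p x p0 p1.
have [Q [QE _]] := exists_discrete_law q x q0 q1.
have [Pn [PnE Pnint]] := exists_discrete_law
  (fun f : {ffun 'I_n -> I} => \prod_i m (f i)) (sample_of x)
  (fun f => prodr_ge0 _ (fun i _ => m0 (f i)))
  (etrans (sum_prod_ffun n m) (etrans (congr1 (fun a => a ^+ n) m1) (expr1n R n))).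
exists Pn; last first.
  move=> g mg; apply: Pnint => //; first exact: measurable_samples.
  by move=> f i; rewrite /sample_of tnth_mktuple.
have rect (A : 'I_n -> set (k.-tuple R)) :
    Pn [set y | forall i, A i (tnth y i)] =
    (\prod_(i < n) \sum_j m j * (x j \in A i)%:R)%:E.
  rewrite PnE -sum_prod_ffunM; congr EFin; apply: eq_bigr => f _; congr (_ * _).
  have [/[!inE] H|/negP H] := boolP (_ \in _).
    rewrite big1 // => i _; rewrite mem_set //.
    by have := H i; rewrite tnth_mktuple.
  case: (pselect (forall i, A i (x (f i)))) => [H'|].
    by exfalso; apply: H; rewrite inE => i /=; rewrite tnth_mktuple; exact: H'.
  move=> /existsNP [i Hi]; rewrite (bigD1 i) //= memNset // mul0r //.
(* A marginal event is a rectangle with full sides in the other directions. *)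
have marg (i : 'I_n) (A : set (k.-tuple R)) :
    Pn [set y | A (tnth y i)] = (\sum_j m j * (x j \in A)%:R)%:E.
  pose B i' := if i' == i then A else setT.
  have -> : [set y | A (tnth y i)] = [set y : n.-tuple _ | forall i', B i' (tnth y i')].
    apply/seteqP; split=> [y /= Ay i'|y /(_ i)]; rewrite /B ?eqxx //.
    by case: eqP => [->|].
  rewrite rect (bigD1 i) //= [X in _ * X]big1 => [|i' /negPf i'i].
    by rewrite mulr1 /B eqxx.
  by rewrite /B i'i -[RHS]m1; apply: eq_bigr => j _; rewrite in_setT mulr1.
have in1 (w : I -> R) : \sum_i w i = 1 -> (\sum_i w i * (x i \in simplex)%:R)%:E = 1%E.
  move=> w1; rewrite -[X in _ = X%:E]w1; congr EFin; apply: eq_bigr => i _.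
  by rewrite mem_set ?mulr1.
exists P, Q; split.
- by rewrite PE in1.
- by rewrite QE in1.
- move=> j; rewrite unlock.
  by rewrite Pint ?thetaE //; exact: measurable_tnth.
- split=> [i A _|A _].
    rewrite marg /HC_mixture PE QE -!EFinM -EFinD; congr EFin.
    rewrite !mulr_sumr -big_split /=; apply: eq_bigr => j _.
    by rewrite mE mulrDl !mulrA.
  by rewrite rect -prodEFin; apply: eq_bigr => i _; rewrite marg.
Qed.
End discrete_model.

(** * Two-point testing and Assouad's argument *)

Lemma bernoulli_ge {R : realFieldType} (h : R) n :
  0 <= h <= 1 -> 1 - n%:R * h <= (1 - h) ^+ n.
Proof.
move=> /andP[h0 h1]; elim: n => [|n IH]; first by rewrite mul0r subr0 expr0.
rewrite exprS; apply: (@le_trans _ _ ((1 - h) * (1 - n%:R * h))); last first.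
  by apply: ler_wpM2l => //; lra.
rewrite -natr1; have : 0 <= n%:R * (h * h) by rewrite !mulr_ge0.
by move: (n%:R : R) => N; nra.
Qed.

(** Linear substitute for the bound of the total affinity [sum (min p q)] by the
    squared Hellinger affinity.  If [p <= q], the arithmetic-geometric mean
    inequality gives [sqrt (p * q) <= p + q / 4]; the summed lower bound, with
    [p] and [q] of total mass one, is the Hellinger affinity minus [1 / 2], which
    suffices when the latter is at least [3 / 4]. *)
Lemma min_ge_sqrt {R : realFieldType} (p q r : R) :
  0 <= p -> 0 <= q -> 0 <= r -> r ^+ 2 = p * q -> r - (p + q) / 4 <= Num.min p q.
Proof.
have key (a b : R) : 0 <= a -> a <= b -> 0 <= r -> r ^+ 2 = a * b -> r - (a + b) / 4 <= a.
  move=> a0 ab r0 rab; rewrite leNgt; apply/negP => lt.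
  have : (a + b / 4) ^+ 2 < r ^+ 2 by rewrite ltrXn2r ?nnegrE //; lra.
  by rewrite rab; have := sqr_ge0 (a - b / 4); nra.
move=> p0 q0 r0 rE; case: (leP p q) => pq; first exact: key.
by rewrite [p + q]addrC; apply: key => //; [exact: ltW|rewrite mulrC].
Qed.

(** The Hellinger affinity of product laws is the power of the affinity of the
    factors, here at least [(1 - h) ^ n >= 1 - n h >= 3 / 4]. *)
Lemma prod_affinity {R : rcfType} {I : finType} (n : nat) (p q : I -> R) (h : R) :
  (forall i, 0 <= p i) -> \sum_i p i = 1 ->
  (forall i, 0 <= q i) -> \sum_i q i = 1 ->
  0 <= h <= 1 -> n%:R * h <= 1 / 4 ->
  1 - h <= \sum_i Num.sqrt (p i * q i) ->
  1 / 4 <= \sum_(f : {ffun 'I_n -> I})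
    Num.min (\prod_i p (f i)) (\prod_i q (f i)).
Proof.
move=> p0 p1 q0 q1 h01 nh aff.
apply: (@le_trans _ _ (\sum_(f : {ffun 'I_n -> I})
    (\prod_i Num.sqrt (p (f i) * q (f i)) -
     (\prod_i p (f i) + \prod_i q (f i)) / 4))); last first.
  apply: ler_sum => f _; apply: min_ge_sqrt; try exact: prodr_ge0.
  rewrite -prodrXl -big_split /=; apply: eq_bigr => i _.
  by rewrite sqr_sqrtr // mulr_ge0.
rewrite sumrB -mulr_suml big_split /= !sum_prod_ffun p1 q1 expr1n.
have : (1 - h) ^+ n <= (\sum_i Num.sqrt (p i * q i)) ^+ n.
  have h0 : 0 <= 1 - h by lra.
  by rewrite lerXn2r // nnegrE // sumr_ge0 // => i _; exact: sqrtr_ge0.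
have := @bernoulli_ge _ h n h01.
by rewrite (sum_prod_ffun n (fun j => Num.sqrt (p j * q j))); lra.
Qed.

Definition flip {m : nat} (j : 'I_m) (t : {ffun 'I_m -> bool}) : {ffun 'I_m -> bool} :=
  [ffun i => t i (+) (i == j)].

Lemma flipK {m} (j : 'I_m) : involutive (flip j).
Proof. by move=> t; apply/ffunP => i; rewrite !ffunE -addbA addbb addbF. Qed.

Lemma flipE {m} (j : 'I_m) t : flip j t j = ~~ t j.
Proof. by rewrite ffunE eqxx addbT. Qed.

(** Coordinate by coordinate, pair each sign vector [t] with [flip j t].  On a
    given observation the losses for the two values of the [j]-th sign add up to
    at least [delta], and both observation laws charge it with at least the
    minimum of their masses, so the pair contributes at least [delta * alpha].
    The factor [1 / 2] comes from counting every pair twice. *)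
Lemma assouad {R : realFieldType} {m : nat} {F : finType}
    (P : {ffun 'I_m -> bool} -> F -> R) (loss : 'I_m -> bool -> F -> R)
    (delta alpha : R) :
  (forall t f, 0 <= P t f) -> 0 <= delta ->
  (forall j b f, 0 <= loss j b f) ->
  (forall j b f, delta <= loss j b f + loss j (~~ b) f) ->
  (forall t j, alpha <= \sum_f Num.min (P t f) (P (flip j t) f)) ->
  #|{ffun 'I_m -> bool}|%:R * (m%:R * (delta * alpha / 2)) <=
  \sum_t \sum_f P t f * \sum_j loss j (t j) f.
Proof.
move=> P0 d0 l0 ld aff.
have two j : #|{ffun 'I_m -> bool}|%:R * (delta * alpha / 2) <=
    \sum_t \sum_f P t f * loss j (t j) f.
  set S := \sum_t _.
  have SE : S = \sum_t \sum_f P (flip j t) f * loss j (~~ t j) f.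
    rewrite /S (reindex_inj (inv_inj (flipK j))) /=.
    by apply: eq_bigr => t _; rewrite flipE.
  suff : #|{ffun 'I_m -> bool}|%:R * (delta * alpha) <= S + S by lra.
  rewrite {2}SE /S -big_split /= mulr_natl -sumr_const; apply: ler_sum => t _.
  rewrite -big_split /=; apply: (le_trans (ler_wpM2l d0 (aff t j))).
  rewrite mulr_sumr; apply: ler_sum => f _.
  have := ld j (t j) f; have := l0 j (t j) f; have := l0 j (~~ t j) f.
  have := P0 t f; have := P0 (flip j t) f.
  move: (P t f) (P _ f) (loss _ _ _) (loss _ _ _) => u v x y v0 u0 y0 x0 dxy.
  by case: (leP u v) => uv; nra.
under eq_bigr do under eq_bigr do rewrite mulr_sumr.
under eq_bigr do rewrite exchange_big /=.
rewrite exchange_big /= mulrCA mulr_natl.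
rewrite -[X in _ *+ X]card_ord -sumr_const.
exact: ler_sum.
Qed.

(** * Risk lower bounds for a general distance *)

Section risk.
Context {R : realType} {k : nat}.
Implicit Types (dist : k.-tuple R -> k.-tuple R -> R) (u theta : k.-tuple R).

(** The worst-case risk dominates any Bayes risk for the uniform prior on a finite
    family of parameters. *)
Lemma HC_risk_ge_average dist n (eps : R) (Theta : set (k.-tuple R)) est
    {J : finType} (j0 : J) (theta : J -> k.-tuple R)
    (Pn : J -> probability (n.-tuple (k.-tuple R)) R) (r : J -> R) (v : R) :
  (forall j, Theta (theta j)) -> (forall j, HC_model eps (theta j) (Pn j)) ->
  (forall j, (\int[Pn j]_(x in @samples R k n) (dist (est x) (theta j))%:E)%E =
     (r j)%:E) ->
  #|J|%:R * v <= \sum_j r j ->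
  (v%:E <= HC_risk dist eps Theta est)%E.
Proof.
move=> Th Mo rE vr.
have [j vrj] : exists j, v <= r j.
  apply/existsP; rewrite -[X in is_true X]negbK negb_exists; apply/negP => /forallP lt.
  move: vr; apply/negP; rewrite -ltNge mulr_natl -sumr_const.
  apply: ltr_sum => [|j _]; last by rewrite ltNge.
  by apply/hasP; exists j0; rewrite ?mem_index_enum.
apply: (@le_trans _ _ (r j)%:E); first by rewrite lee_fin.
rewrite -rE; apply: le_trans (ereal_sup_ubound _); last by exists (theta j).
by apply: ereal_sup_ubound; exists (Pn j).
Qed.

Definition vertex (i : 'I_k) : k.-tuple R := [tuple (i == j)%:R | j < k].

Lemma simplex_vertex i : simplex (vertex i).
Proof.
split=> [j|]; first by rewrite tnth_mktuple ler0n.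
rewrite (bigD1 i) //= tnth_mktuple eqxx big1 ?addr0 // => j /negPf ji.
by rewrite tnth_mktuple eq_sym ji.
Qed.

Definition vertex_mean {I : finType} (idx : I -> 'I_k) (p : I -> R) : k.-tuple R :=
  [tuple \sum_i p i * tnth (vertex (idx i)) j | j < k].

Lemma simplex_vertex_mean {I : finType} (idx : I -> 'I_k) (p : I -> R) :
  (forall i, 0 <= p i) -> \sum_i p i = 1 -> simplex (vertex_mean idx p).
Proof.
move=> p0 p1; split=> [j|].
  rewrite tnth_mktuple sumr_ge0 // => i _; rewrite mulr_ge0 //.
  by case: (simplex_vertex (idx i)).
under eq_bigr do rewrite tnth_mktuple.
rewrite exchange_big /= -[RHS]p1; apply: eq_bigr => i _.
by rewrite -mulr_sumr; case: (simplex_vertex (idx i)) => _ ->; rewrite mulr1.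
Qed.

Lemma tnth_vertex_mean {I : finType} (idx : I -> 'I_k) (p : I -> R) i :
  injective idx -> tnth (vertex_mean idx p) (idx i) = p i.
Proof.
move=> idxI; rewrite tnth_mktuple (bigD1 i) //= tnth_mktuple eqxx mulr1.
rewrite big1 ?addr0 // => i' /negPf i'i.
by rewrite tnth_mktuple (inj_eq idxI) i'i mulr0.
Qed.

Lemma sparse_vertex_mean {I : finType} (idx : I -> 'I_k) (p : I -> R) s :
  (forall i, 0 <= p i) -> \sum_i p i = 1 -> (#|I| <= s)%N ->
  sparse_simplex s (vertex_mean idx p).
Proof.
move=> p0 p1 Is; split; first exact: simplex_vertex_mean.
apply: leq_trans Is; apply: leq_trans (leq_imset_card idx I).
apply: subset_leq_card; apply/fintype.subsetP => j; rewrite inE tnth_mktuple.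
apply: contraR => jI; rewrite big1 // => i _; rewrite tnth_mktuple.
case: eqP => [E|_]; last by rewrite mulr0.
by move: jI; rewrite -E imset_f.
Qed.

Lemma HC_model_vertex dist {I : finType} n (eps : R) (idx : I -> 'I_k) est
    (p q m : I -> R) :
  (forall u, measurable_fun setT (dist^~ u)) ->
  @estimators R k n est ->
  (forall i, 0 <= p i) -> \sum_i p i = 1 ->
  (forall i, 0 <= q i) -> \sum_i q i = 1 -> (forall i, 0 <= m i) ->
  (forall i, m i = (1 - eps) * p i + eps * q i) ->
  exists2 Pn, HC_model (n := n) eps (vertex_mean idx p) Pn &
    (\int[Pn]_(x in @samples R k n) (dist (est x) (vertex_mean idx p))%:E)%E =
    (\sum_(f : {ffun 'I_n -> I}) (\prod_i m (f i)) *
       dist (est (sample_of (vertex \o idx) f)) (vertex_mean idx p))%:E.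
Proof.
move=> md [mest _] p0 p1 q0 q1 m0 mE.
have [|j|Pn HPn intPn] := @HC_model_discrete R k I n eps (vertex \o idx) p q m
  (vertex_mean idx p) p0 p1 q0 q1 m0 mE.
- by move=> i; exact: simplex_vertex.
- by rewrite tnth_mktuple.
exists Pn => //.
exact: (intPn (fun y => dist (est y) (vertex_mean idx p)) (measurableT_comp (md _) mest)).
Qed.

Lemma samples_vertex {I : finType} n (idx : I -> 'I_k) (f : {ffun 'I_n -> I}) :
  samples (sample_of (vertex \o idx) f).
Proof. by move=> i; rewrite tnth_mktuple; exact: simplex_vertex. Qed.

(** The laws [d_e0] and [M = (1 - eps) d_e0 + eps d_e1], with [e0], [e1] the
    vertices [i0], [i1], become the same law [M] once contaminated by [d_e1]
    and by [M] respectively.  The two parameters are distinguished only through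
    their coordinate [i1], which is [0] or [eps]. *)
Lemma contamination_lower_bound dist n s (eps D : R) (i0 i1 : 'I_k) est :
  (2 <= s)%N -> 0 <= eps <= 1 -> i0 != i1 ->
  (forall u, measurable_fun setT (dist^~ u)) ->
  (forall t u u', tnth u i1 = 0 -> tnth u' i1 = eps ->
     D <= dist t u + dist t u') ->
  @estimators R k n est ->
  ((D / 2)%:E <= HC_risk dist eps (@sparse_simplex R k s) est)%E.
Proof.
move=> s2 /andP[e0 e1] i01 md HD estE.
pose idx (b : bool) := if b then i1 else i0.
pose m (b : bool) := if b then eps else 1 - eps.
pose p (b : bool) : R := if b then 0 else 1.
pose q (b : bool) : R := if b then 1 else 0.
have idxI : injective idx.
  by case=> [] [] //= /eqP; rewrite ?[i1 == _]eq_sym (negPf i01).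
have m0 b : 0 <= m b by case: b => /=; lra.
have p0 b : 0 <= p b by case: b => /=; lra.
have q0 b : 0 <= q b by case: b => /=; lra.
have m1 : \sum_b m b = 1 by rewrite big_bool /=; lra.
have p1 : \sum_b p b = 1 by rewrite big_bool /=; lra.
have q1 : \sum_b q b = 1 by rewrite big_bool /=; lra.
have mpq b : m b = (1 - eps) * p b + eps * q b by case: b => /=; lra.
have mm b : m b = (1 - eps) * m b + eps * m b by ring.
have [P0 HP0 intP0] := HC_model_vertex dist n eps idx est
  p q m md estE p0 p1 q0 q1 m0 mpq.
have [P1 HP1 intP1] := HC_model_vertex dist n eps idx est
  m m m md estE m0 m1 m0 m1 m0 mm.
pose theta (b : bool) := vertex_mean idx (if b then m else p).
apply: (@HC_risk_ge_average dist n eps _ est _ true theta (fun b => if b then P1 else P0)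
  (fun b => \sum_(f : {ffun 'I_n -> bool}) (\prod_i m (f i)) *
       dist (est (sample_of (vertex \o idx) f)) (theta b))).
- by case; apply: sparse_vertex_mean => //; rewrite card_bool.
- by case.
- by case.
rewrite card_bool big_bool /= -big_split /=.
have -> : 2 * (D / 2) = \sum_(f : {ffun 'I_n -> bool}) (\prod_i m (f i)) * D.
  by rewrite -mulr_suml sum_prod_ffun m1 expr1n; lra.
apply: ler_sum => f _; rewrite -mulrDr; apply: ler_wpM2l.
  exact: prodr_ge0.
by rewrite addrC; apply: HD; exact: (tnth_vertex_mean _ _ true idxI).
Qed.

(** Assouad's argument for the weights [(1 +/- a) / (2m)] on [m] pairs of
    vertices, with [a = sqrt (m / n) / 2].  Only the first coordinate of each
    pair is tested, so a single hypothesis on [dist] covers both a sum over [m]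
    coordinates and, for [m = 1], one coordinate of the L2 norm. *)
Lemma sampling_lower_bound dist n s m (eps kappa : R) est :
  (0 < m)%N -> (2 * m <= s)%N -> (2 * m <= k)%N -> (m <= n)%N -> 0 <= kappa ->
  (forall u, measurable_fun setT (dist^~ u)) ->
  (forall (g : 'I_m -> 'I_k) t u, injective g -> simplex t -> simplex u ->
     kappa * \sum_j `|tnth t (g j) - tnth u (g j)| <= dist t u) ->
  @estimators R k n est ->
  ((kappa * (Num.sqrt (m%:R / n%:R) / 16))%:E <=
    HC_risk dist eps (@sparse_simplex R k s) est)%E.
Proof.
move=> m0 ms mk mn kap0 md dk estE.
set rt := Num.sqrt _.
pose a := rt / 2.
have mp : (0 : R) < m%:R by rewrite ltr0n.
have np : (0 : R) < n%:R by rewrite ltr0n; lia.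
have a0 : 0 <= a by rewrite divr_ge0 // sqrtr_ge0.
have aa : a ^+ 2 = m%:R / n%:R / 4.
  rewrite expr_div_n sqr_sqrtr; last by rewrite divr_ge0 // ltW.
  by rewrite -natrX.
have mn1 : m%:R / n%:R <= 1 :> R by rewrite ler_pdivrMr // mul1r ler_nat.
have a1 : a <= 1 by rewrite leNgt; apply/negP => a1; nra.
pose I := ('I_m * bool)%type.
have idxP (c : I) : (2 * c.1 + c.2 < k)%N.
  by case: c => [[j jm] [] /=]; lia.
pose idx (c : I) : 'I_k := Ordinal (idxP c).
have idxI : injective idx.
  move=> [j b] [j' b'] [] /= E; have bb : b = b'.
    by case: b b' E => [] [] //=; lia.
  by rewrite bb in E *; congr pair; apply: val_inj => /=; lia.
pose val_ (b : bool) : R := (if b then 1 + a else 1 - a) / (2 * m%:R).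
have val_0 b : 0 <= val_ b.
  by rewrite divr_ge0 // ?mulr_ge0 //; case: b; lra.
(* The sign [t j] decides which of the vertices [2j] and [2j + 1] is heavier. *)
pose p (t : {ffun 'I_m -> bool}) (c : I) := val_ (c.2 (+) t c.1).
have sum_pair (F : I -> R) : \sum_c F c = \sum_j (F (j, true) + F (j, false)).
  rewrite (eq_bigr (fun c : I => F (c.1, c.2))); last by case.
  rewrite -(pair_bigA _ (fun j b => F (j, b))) /=.
  by apply: eq_bigr => j _; rewrite big_bool.
have val_tf : val_ true + val_ false = m%:R^-1 by rewrite /val_; field; lra.
have val_tf' b : val_ b + val_ (~~ b) = m%:R^-1 by case: b => //; rewrite addrC.
have p0 (t : {ffun 'I_m -> bool}) c : 0 <= p t c by exact: val_0.
have sumV : \sum_(j < m) (m%:R^-1 : R) = 1.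
  by rewrite sumr_const card_ord -[LHS]mulr_natl divff // lt0r_neq0.
have p1 (t : {ffun 'I_m -> bool}) : \sum_c p t c = 1.
  rewrite sum_pair (eq_bigr (fun _ => m%:R^-1)) => [|j _].
    exact: sumV.
  by rewrite /p /= addrC val_tf'.
have affp (t : {ffun 'I_m -> bool}) j : 1 / 4 <= \sum_(f : {ffun 'I_n -> I})
    Num.min (\prod_i p t (f i)) (\prod_i p (flip j t) (f i)).
  apply: (prod_affinity n (p t) (p (flip j t)) (a ^+ 2 / m%:R)) => //.
  - apply/andP; split; first by rewrite divr_ge0 // sqr_ge0.
    rewrite ler_pdivrMr // mul1r.
    by apply: (@le_trans _ _ 1); [nra|rewrite ler1n].
  (* This is where the size of [a] matters: [n * (a ^+ 2 / m) = 1 / 4]. *)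
  - rewrite aa; have -> : n%:R * (m%:R / n%:R / 4 / m%:R) = 1 / 4 :> R.
      by field; rewrite !lt0r_neq0.
    by [].
  - have -> : 1 - a ^+ 2 / m%:R =
        \sum_(j' < m) (m%:R^-1 - (j' == j)%:R * (a ^+ 2 / m%:R)).
      rewrite sumrB -mulr_suml sumV.
      rewrite (bigD1 j) //= eqxx big1 ?addr0 ?mul1r // => j' /negPf -> //.
    rewrite sum_pair; apply: ler_sum => j' _.
    rewrite /p /= ffunE.
    case: eqP => [->|_]; last first.
      by rewrite addbF mul0r subr0 -!expr2 !sqrtr_sqr !ger0_norm // addrC val_tf'.
    (* On the flipped pair both factors are equal, and [sqrt (1 - a ^+ 2)] is
       bounded below by [1 - a ^+ 2]. *)
    rewrite addbT negbK [X in _ + Num.sqrt X]mulrC.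
    have -> : val_ (~~ t j) * val_ (t j) = (1 - a ^+ 2) / (2 * m%:R) ^+ 2.
      by rewrite /val_; case: (t j) => /=; field; rewrite lt0r_neq0.
    have : (1 - a ^+ 2) / (2 * m%:R) <= Num.sqrt ((1 - a ^+ 2) / (2 * m%:R) ^+ 2).
      have a2 : 0 <= 1 - a ^+ 2 <= 1 by nra.
      rewrite -[leLHS]ger0_norm; last by rewrite divr_ge0 ?mulr_ge0 //; lra.
      rewrite -sqrtr_sqr ler_wsqrtr // expr_div_n ler_wpM2r ?invr_ge0 ?sqr_ge0 //.
      by nra.
    have -> : (1 - a ^+ 2) / (2 * m%:R) = (m%:R^-1 - 1 * (a ^+ 2 / m%:R)) / 2.
      by field; rewrite lt0r_neq0.
    by rewrite mulr1n; set V := m%:R^-1; set W := a ^+ 2 / _; set Q := Num.sqrt _; lra.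
pose xs (f : {ffun 'I_n -> I}) := est (sample_of (vertex \o idx) f).
pose theta (t : {ffun 'I_m -> bool}) := vertex_mean idx (p t).
pose g (j : 'I_m) := idx (j, false).
pose loss (j : 'I_m) b f := `|tnth (xs f) (g j) - val_ b|.
have HA := @assouad R m _
  (fun (t : {ffun 'I_m -> bool}) (f : {ffun 'I_n -> I}) => \prod_i p t (f i))
  loss (a / m%:R) (1 / 4).
have pp (t : {ffun 'I_m -> bool}) c : p t c = (1 - eps) * p t c + eps * p t c by ring.
have Pn_ (t : {ffun 'I_m -> bool}) := cid2 (HC_model_vertex dist n eps idx est
  (p t) (p t) (p t) md estE (p0 t) (p1 t) (p0 t) (p1 t) (p0 t) (pp t)).
apply: (@HC_risk_ge_average dist n eps _ est _ [ffun=> true] theta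
  (fun (t : {ffun 'I_m -> bool}) => s2val (Pn_ t))
  (fun (t : {ffun 'I_m -> bool}) =>
     \sum_(f : {ffun 'I_n -> I}) (\prod_i p t (f i)) * dist (xs f) (theta t))).
- move=> t; apply: sparse_vertex_mean => //.
  by rewrite card_prod card_bool card_ord mulnC.
- by move=> t; exact: (s2valP (Pn_ t)).
- by move=> t; exact: (s2valP' (Pn_ t)).
apply: (@le_trans _ _ (kappa * \sum_(t : {ffun 'I_m -> bool})
    \sum_(f : {ffun 'I_n -> I}) (\prod_i p t (f i)) * \sum_j loss j (t j) f)).
  rewrite mulrCA; apply: ler_wpM2l => //.
  apply: le_trans (HA _ _ _ _ _) => //.
  - apply: ler_wpM2l => //; rewrite /a.
    have -> : m%:R * (rt / 2 / m%:R * (1 / 4) / 2) = rt / 16.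
      by field; rewrite lt0r_neq0.
    by [].
  - by move=> t f; exact: prodr_ge0.
  - by rewrite divr_ge0 // ltW.
  - by move=> j b f; rewrite /loss normr_ge0.
  - move=> j b f; rewrite /loss.
    have -> : a / m%:R = `|val_ b - val_ (~~ b)|.
      have -> : val_ b - val_ (~~ b) = (-1) ^+ (~~ b) * (a / m%:R).
        by rewrite /val_; case: b => /=; rewrite ?expr0 ?expr1; field; rewrite lt0r_neq0.
      by rewrite normrM normr_sign mul1r ger0_norm // divr_ge0 // ltW.
    by rewrite [X in _ <= X + _]distrC; exact: ler_distD.
rewrite mulr_sumr; apply: ler_sum => t _; rewrite mulr_sumr; apply: ler_sum => f _.
rewrite mulrCA; apply: ler_wpM2l; first exact: prodr_ge0.
apply: le_trans (dk g (xs f) (theta t) _ _ _); last 3 first.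
- by move=> j j' /idxI [].
- by case: estE => _; apply; exact: samples_vertex.
- exact: simplex_vertex_mean.
apply: ler_wpM2l => //; apply: ler_sum => j _.
by rewrite /loss /theta /g tnth_vertex_mean // /p addFb.
Qed.
End risk.

(** * The three distances *)

Section distances.
Context {R : realType} {k : nat}.
Implicit Types (t u : k.-tuple R).

Lemma measurable_fun_sqrt : measurable_fun [set: R] (@Num.sqrt R).
Proof. by apply: continuous_measurable_fun; exact: sqrt_continuous. Qed.

Lemma measurable_tnthB (j : 'I_k) (c : R) :
  measurable_fun [set: k.-tuple R] (fun t => tnth t j - c).
Proof. by apply: measurable_funB => //; exact: measurable_tnth. Qed.

Lemma measurable_dTV u : measurable_fun [set: k.-tuple R] (fun t => dTV t u).
Proof.
apply: measurable_funM => //; apply: measurable_sum => j.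
apply: measurableT_comp; last exact: measurable_tnthB.
exact: normr_measurable.
Qed.

Lemma measurable_dL2 u : measurable_fun [set: k.-tuple R] (fun t => dL2 t u).
Proof.
apply: measurableT_comp; first exact: measurable_fun_sqrt.
apply: measurable_sum => j.
by apply: measurable_funX; exact: measurable_tnthB.
Qed.

Lemma measurable_dH u : measurable_fun [set: k.-tuple R] (fun t => dH t u).
Proof.
apply: measurableT_comp; first exact: measurable_fun_sqrt.
apply: measurable_sum => j; apply: measurable_funX.
apply: measurable_funB => //; apply: measurableT_comp; first exact: measurable_fun_sqrt.
exact: measurable_tnth.
Qed.

Lemma sum_inj_le {m} (g : 'I_m -> 'I_k) (F : 'I_k -> R) :
  injective g -> (forall i, 0 <= F i) -> \sum_j F (g j) <= \sum_i F i.
Proof.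
move=> gI F0; rewrite [leRHS](bigID (mem (g @: 'I_m)%SET)) /=.
rewrite big_imset /=; last by move=> ? ? _ _; exact: gI.
by rewrite lerDl sumr_ge0.
Qed.

Lemma term_le_sqrt_sum (F : 'I_k -> R) i :
  `|F i| <= Num.sqrt (\sum_j F j ^+ 2).
Proof.
rewrite -sqrtr_sqr ler_wsqrtr // (bigD1 i) //= lerDl.
by rewrite sumr_ge0 // => j _; exact: sqr_ge0.
Qed.

Lemma dTV_ge_sum {m} (g : 'I_m -> 'I_k) t u : injective g ->
  2^-1 * \sum_j `|tnth t (g j) - tnth u (g j)| <= dTV t u.
Proof.
move=> gI; rewrite ler_wpM2l ?invr_ge0 //.
exact: (sum_inj_le g (fun i => `|tnth t i - tnth u i|)).
Qed.

(** Factor [|a - b| = |sqrt a - sqrt b| * (sqrt a + sqrt b)] and apply the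
    Cauchy-Schwarz inequality; the squares of the second factors sum to at most
    [2 * sum (a + b) = 4]. *)
Lemma dTV_le_dH t u : simplex t -> simplex u -> dTV t u <= dH t u.
Proof.
move=> [t0 t1] [u0 u1]; pose x j := `|Num.sqrt (tnth t j) - Num.sqrt (tnth u j)|.
pose y j := Num.sqrt (tnth t j) + Num.sqrt (tnth u j).
set X := \sum_(j < k) (Num.sqrt (tnth t j) - Num.sqrt (tnth u j)) ^+ 2.
pose S := \sum_j x j * y j.
have dS : dTV t u = S / 2.
  rewrite mulrC /dTV; congr (_ * _); apply: eq_bigr => j _.
  rewrite /x -[y j]ger0_norm ?addr_ge0 ?sqrtr_ge0 // -normrM -subr_sqr.
  by rewrite !sqr_sqrtr.
have Y4 : \sum_j y j ^+ 2 <= 4.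
  have -> : 4 = \sum_j 2 * (tnth t j + tnth u j).
    by rewrite -mulr_sumr big_split /= t1 u1; lra.
  apply: ler_sum => j _; rewrite /y.
  have := sqr_sqrtr (t0 j); have := sqr_sqrtr (u0 j).
  by have := sqr_ge0 (Num.sqrt (tnth t j) - Num.sqrt (tnth u j)); nra.
have XE : X = \sum_j x j ^+ 2 by apply: eq_bigr => j _; rewrite real_normK ?num_real.
have S0 : 0 <= S.
  by apply: sumr_ge0 => j _; rewrite mulr_ge0 ?normr_ge0 ?addr_ge0 ?sqrtr_ge0.
(* Cauchy-Schwarz from one sum of squares.  The weight [4], an upper bound of
   [sum (y j ^+ 2)], replaces that sum itself. *)
have : 0 <= \sum_j (4 * x j - S * y j) ^+ 2 by apply: sumr_ge0 => j _; exact: sqr_ge0.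
rewrite (eq_bigr (fun j => 16 * x j ^+ 2 - 8 * S * (x j * y j) +
  S ^+ 2 * y j ^+ 2)); last first.
  by move=> j _; ring.
rewrite big_split /= sumrB -!mulr_sumr -XE -/S => H.
have SX : (S / 2) ^+ 2 <= X by nra.
rewrite dS /dH -/X -[leLHS]ger0_norm ?divr_ge0 //.
by rewrite -sqrtr_sqr ler_wsqrtr.
Qed.

Lemma dTV_ge_coord t u i : 2^-1 * `|tnth t i - tnth u i| <= dTV t u.
Proof.
rewrite ler_wpM2l ?invr_ge0 // (bigD1 i) //= lerDl.
by rewrite sumr_ge0.
Qed.

Lemma dL2_ge_coord t u i : `|tnth t i - tnth u i| <= dL2 t u.
Proof. exact: (term_le_sqrt_sum (fun i => tnth t i - tnth u i)). Qed.

Lemma dH_ge_coord t u i : `|Num.sqrt (tnth t i) - Num.sqrt (tnth u i)| <= dH t u.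
Proof.
exact: (term_le_sqrt_sum (fun i => Num.sqrt (tnth t i) - Num.sqrt (tnth u i))).
Qed.
End distances.

(** * The minimax lower bounds *)

Lemma HC_minimax_ge_half_sum {R : realType} {k n : nat} dist (eps : R) Theta (a b c : R) :
  (forall est, @estimators R k n est -> (a%:E <= HC_risk dist eps Theta est)%E) ->
  (forall est, @estimators R k n est -> (b%:E <= HC_risk dist eps Theta est)%E) ->
  c <= (a + b) / 2 ->
  (c%:E <= HC_minimax dist n eps Theta)%E.
Proof.
move=> Ha Hb cab; apply: le_ereal_inf_tmp => _ [est estE <-].
case: (leP a b) => ab.
  by apply: le_trans (Hb _ estE); rewrite lee_fin; lra.
by apply: le_trans (Ha _ estE); rewrite lee_fin; lra.
Qed.

Theorem theorem2 (R : realType) :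
  exists (c : R) (n0 : nat), 0 < c /\
    forall (k s n : nat) (eps : R),
      (3 <= k)%N -> (2 <= s)%N -> (s <= minn k n)%N -> (n0 <= n)%N ->
      0 <= eps <= 1 ->
      [/\ ((c * (Num.sqrt (s%:R / n%:R) + eps))%:E <=
             HC_minimax dTV n eps (@sparse_simplex R k s))%E,
          ((c * (Num.sqrt (s%:R / n%:R) + Num.sqrt eps))%:E <=
             HC_minimax dH n eps (@sparse_simplex R k s))%E &
          ((c * (Num.sqrt (1 / n%:R) + eps))%:E <=
             HC_minimax dL2 n eps (@sparse_simplex R k s))%E].
Proof.
(* The sampling bounds in total variation and Hellinger are binding: they are
   [sqrt (m / n) / 32], with [m = s./2 >= s / 4], and averaging with the
   contamination bound costs a further factor [2]. *)
exists (1 / 128), 0; split=> [|k s n eps k3 s2 skn _ eps01]; first lra.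
have [sk sn] : (s <= k)%N /\ (s <= n)%N by apply/andP; rewrite -leq_min.
have k0 : (0 < k)%N by lia. have k1 : (1 < k)%N by lia.
pose i0 := Ordinal k0; pose i1 := Ordinal k1.
have i01 : i0 != i1 by [].
have e0 : 0 <= eps by case/andP: eps01.
pose m := s./2.
have m0 : (0 < m)%N by rewrite /m; lia.
have ms : (2 * m <= s)%N by rewrite /m; lia.
have mk : (2 * m <= k)%N by lia.
have mn : (m <= n)%N by lia.
have np : (0 : R) < n%:R by rewrite ltr0n; lia.
have rate : Num.sqrt (s%:R / n%:R) <= 2 * Num.sqrt (m%:R / n%:R) :> R.
  have -> : 2 = Num.sqrt (2 ^+ 2) :> R by rewrite sqrtr_sqr ger0_norm.
  rewrite -sqrtrM ?sqr_ge0 // ler_wsqrtr // mulrA ler_wpM2r ?invr_ge0 ?(ltW np) //.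
  by rewrite -natrX -natrM ler_nat /m; lia.
have rate0 : 0 <= Num.sqrt (s%:R / n%:R) :> R by exact: sqrtr_ge0.
have dTV_sampling (g : 'I_m -> 'I_k) t u : injective g -> simplex t -> simplex u ->
    2^-1 * \sum_j `|tnth t (g j) - tnth u (g j)| <= dTV t u :> R.
  by move=> gI _ _; exact: dTV_ge_sum.
split.
- apply: HC_minimax_ge_half_sum.
  + move=> est; apply: (sampling_lower_bound dTV n s m eps 2^-1) => //.
    exact: measurable_dTV.
  + move=> est; apply: (contamination_lower_bound dTV n s eps (eps / 2) i0 i1) => //.
      exact: measurable_dTV.
    move=> t u u' ui u'i.
    have := dTV_ge_coord t u i1; have := dTV_ge_coord t u' i1.
    have := ler_distD (tnth t i1) (tnth u' i1) (tnth u i1).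
    rewrite ui u'i subr0 ger0_norm // [`|eps - _|]distrC; lra.
  + lra.
- apply: HC_minimax_ge_half_sum.
  + move=> est; apply: (sampling_lower_bound dH n s m eps 2^-1) => //.
      exact: measurable_dH.
    by move=> g t u gI tS uS; apply: le_trans (dTV_le_dH t u tS uS); exact: dTV_sampling.
  + move=> est; apply: (contamination_lower_bound dH n s eps (Num.sqrt eps) i0 i1) => //.
      exact: measurable_dH.
    move=> t u u' ui u'i.
    have := dH_ge_coord t u i1; have := dH_ge_coord t u' i1.
    have := ler_distD (Num.sqrt (tnth t i1))
      (Num.sqrt (tnth u' i1)) (Num.sqrt (tnth u i1)).
    rewrite ui u'i sqrtr0 subr0 [X in X <= _ -> _]ger0_norm ?sqrtr_ge0 //.
    rewrite [`|Num.sqrt eps - _|]distrC; lra.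
  + have : 0 <= Num.sqrt eps by exact: sqrtr_ge0.
    lra.
- apply: HC_minimax_ge_half_sum.
  + move=> est; apply: (sampling_lower_bound dL2 n s 1 eps 1) => //; try lia.
      exact: measurable_dL2.
    move=> g t u gI _ _; rewrite big_ord1 mul1r; exact: dL2_ge_coord.
  + move=> est; apply: (contamination_lower_bound dL2 n s eps eps i0 i1) => //.
      exact: measurable_dL2.
    move=> t u u' ui u'i.
    have := dL2_ge_coord t u i1; have := dL2_ge_coord t u' i1.
    have := ler_distD (tnth t i1) (tnth u' i1) (tnth u i1).
    rewrite ui u'i subr0 ger0_norm // [`|eps - _|]distrC; lra.
  + have : 0 <= Num.sqrt (1 / n%:R) :> R by exact: sqrtr_ge0.
    lra.
Qed.
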